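(* Let $\mathcal{H}$ be a separable complex Hilbert space. The sequence induced by each weighted g-frame is a weighted frame: if $\Lambda_i\in\mathcal{L}(\mathcal{H},\mathcal{H}_i)$ and $w_i\in\mathbb{C}$ ($i\in J$) are such that $(w_i\Lambda_i)_{i\in J}$ is a weighted g-frame of $\mathcal{H}$, and $\{e_{i,k}:k\in K_i\}$ is an orthonormal basis of $\mathcal{H}_i$ for each $i\in J$, then the induced sequence $\{\psi_{i,k}=\Lambda_i^{\star}e_{i,k}:i\in J,k\in K_i\}$ together with the weights $w'_{i,k}=w_i$ ($i\in J$, $k\in K_i$) is a weighted frame of $\mathcal{H}$.
   Context: $J\subseteq\mathbb{Z}$ and $K_i\subseteq\mathbb{Z}$ are index sets, $\{\mathcal{H}_i\}_{i\in J}$ is a sequence of separable complex Hilbert spaces, and $\mathcal{L}(\mathcal{H},\mathcal{H}_i)$ is the set of bounded linear operators $\mathcal{H}\to\mathcal{H}_i$. $(w_i\Lambda_i)_{i\in J}$ is a weighted g-frame of $\mathcal{H}$ if there exist $m>0$, $M<\infty$ with $m\|f\|^2\le\sum_{i\in J}|w_i|^2\|\Lambda_if\|^2\le M\|f\|^2$ for all $f\in\mathcal{H}$. A family $(\psi_n)$ in $\mathcal{H}$ with weights $(w'_n)\subseteq\mathbb{C}$ is a weighted frame of $\mathcal{H}$ if $(w'_n\psi_n)$ is a frame for $\mathcal{H}$, i.e. there exist $m>0$, $M<\infty$ with $m\|f\|^2\le\sum_n|w'_n|^2|\langle f,\psi_n\rangle|^2\le M\|f\|^2$ for all $f\in\mathcal{H}$.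 *)

(* Defs.v *)
From HB Require Import structures.
From mathcomp Require Import all_boot all_order all_algebra.
From mathcomp Require Import complex.
From mathcomp Require Import all_classical all_reals all_analysis.

Set Implicit Arguments.
Unset Strict Implicit.
Unset Printing Implicit Defensive.

Import Order.TTheory GRing.Theory Num.Theory.
Import numFieldNormedType.Exports.

Local Open Scope classical_set_scope.
Local Open Scope ring_scope.

(* Complex Hilbert spaces: complete normed modules over R[i] whose norm is
   induced by a positive definite Hermitian form, linear in its first argument
   and conjugate-linear in its second argument. *)
HB.mixin Record NormedModule_hasInner (R : realType) (H : Type)
    of CompleteNormedModule R[i] H := {
  inner_dot : {dot H for (@Num.conj R[i])} ;
  inner_dot_normE : forall x : H, inner_dot x x = `|x| ^+ 2 }.

#[short(type="hilbertType")]
HB.structure Definition Hilbert (R : realType) :=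
  {H of NormedModule_hasInner R H & CompleteNormedModule R[i] H}.

Definition inner (R : realType) (H : hilbertType R) (x y : H) : R[i] :=
  @inner_dot R H x y.

(* The library norm on a module over R[i] takes values in R[i] (it is a
   nonnegative real there); rnorm is the same number as an element of R. *)
Definition rnorm (R : realType) (V : normedZmodType R[i]) (x : V) : R :=
  complex.Re `|x|.

Definition separable (T : topologicalType) : Prop :=
  exists2 D : set T, countable D & dense D.

Definition bounded_operator (R : realType) (H1 H2 : hilbertType R)
    (L : {linear H1 -> H2}) : Prop :=
  exists M : R, forall x : H1, rnorm (L x) <= M * rnorm x.

(* Chosen by classical choice; for a bounded L, Riesz representation makes the
   vector h exist and be unique, so that the default 0 is never used. *)
Definition adjoint (R : realType) (H1 H2 : hilbertType R)
    (L : {linear H1 -> H2}) (g : H2) : H1 :=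
  xget 0 [set h : H1 | forall f : H1, inner (L f) g = inner f h].

Definition orthonormal_family (R : realType) (H : hilbertType R)
    (T : choiceType) (K : set T) (e : T -> H) : Prop :=
  forall k l, K k -> K l -> inner (e k) (e l) = (k == l)%:R.

Definition lin_span (R : realType) (H : hilbertType R)
    (T : choiceType) (K : set T) (e : T -> H) : set H :=
  [set x | exists (s : seq T) (c : T -> R[i]),
    (forall k, k \in s -> K k) /\ x = \sum_(k <- s) c k *: e k].

Definition orthonormal_basis (R : realType) (H : hilbertType R)
    (T : choiceType) (K : set T) (e : T -> H) : Prop :=
  orthonormal_family K e /\ dense (lin_span K e).

(* The sums below have nonnegative terms; esum is their unordered sum in
   the extended reals, which is +oo when the family is not summable. *)
Definition frame (R : realType) (H : hilbertType R)
    (T : choiceType) (I : set T) (phi : T -> H) : Prop :=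
  exists m M : R, 0 < m /\
    forall f : H,
      ((m * rnorm f ^+ 2)%:E
        <= \esum_(n in I) (rnorm (inner f (phi n)) ^+ 2)%:E)%E /\
      (\esum_(n in I) (rnorm (inner f (phi n)) ^+ 2)%:E
        <= (M * rnorm f ^+ 2)%:E)%E.

Definition weighted_frame (R : realType) (H : hilbertType R)
    (T : choiceType) (I : set T) (w : T -> R[i]) (psi : T -> H) : Prop :=
  frame I (fun n => w n *: psi n).

Definition weighted_g_frame (R : realType) (H : hilbertType R)
    (T : choiceType) (J : set T) (Hi : T -> hilbertType R)
    (w : T -> R[i]) (Lambda : forall i, {linear H -> Hi i}) : Prop :=
  exists m M : R, 0 < m /\
    forall f : H,
      ((m * rnorm f ^+ 2)%:E
        <= \esum_(i in J) (rnorm (w i) ^+ 2 * rnorm (Lambda i f) ^+ 2)%:E)%E /\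
      (\esum_(i in J) (rnorm (w i) ^+ 2 * rnorm (Lambda i f) ^+ 2)%:E
        <= (M * rnorm f ^+ 2)%:E)%E.

Lemma weighted_frameE (R : realType) (H : hilbertType R)
    (T : choiceType) (I : set T) (w : T -> R[i]) (psi : T -> H) :
  weighted_frame I w psi <->
  exists m M : R, 0 < m /\
    forall f : H,
      ((m * rnorm f ^+ 2)%:E
        <= \esum_(n in I)
             (rnorm (w n) ^+ 2 * rnorm (inner f (psi n)) ^+ 2)%:E)%E /\
      (\esum_(n in I) (rnorm (w n) ^+ 2 * rnorm (inner f (psi n)) ^+ 2)%:E
        <= (M * rnorm f ^+ 2)%:E)%E.
Proof.
have E f n : rnorm (inner f (w n *: psi n)) ^+ 2 =
    rnorm (w n) ^+ 2 * rnorm (inner f (psi n)) ^+ 2.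
  rewrite /inner linearZr_LR /= /rnorm normrM norm_conjC -exprMn.
  by rewrite !normc_def /= mulr0 subr0.
rewrite /weighted_frame /frame.
by under eq_exists => m do under eq_exists => M do
  under eq_forall => f do under eq_esum => n _ do rewrite E.
Qed.

(* Main.v *)
(** For [i] in [J], the adjoint turns [inner f (Lambda_i^* e_ik)] into
    [inner (Lambda_i f) e_ik], so Parseval's identity for [w_i Lambda_i f] in
    the basis [(e_ik)_k] gives
      [\sum_k |w_i|^2 |inner f psi_ik|^2 = |w_i|^2 |Lambda_i f|^2];
    summing over [i], the frame sum of the induced sequence equals that of the
    g-frame, with the same bounds.  The adjoint exists by the Riesz
    representation theorem, obtained by minimizing
    [F x = |x|^2 - 2 Re (phi x)]. *)
Require Import Defs.
From mathcomp Require Import all_boot all_order all_algebra.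
From mathcomp Require Import complex.
From mathcomp Require Import all_classical all_reals all_analysis.
From mathcomp Require Import ring lra.

Set Implicit Arguments.
Unset Strict Implicit.
Unset Printing Implicit Defensive.

Import Order.TTheory GRing.Theory Num.Theory.
Import numFieldNormedType.Exports.

Local Open Scope classical_set_scope.
Local Open Scope ring_scope.

(** * The norm as a real number *)

Section RealNorm.
Variables (R : realType) (V : normedZmodType R[i]).
Implicit Types x y : V.

Lemma normE_rnorm x : `|x| = (rnorm x)%:C%C.
Proof. by rewrite /rnorm RRe_real // normr_real. Qed.

Lemma rnorm_ge0 x : 0 <= rnorm x.
Proof. by rewrite -(@lecR R) -normE_rnorm; exact: normr_ge0. Qed.

Lemma rnormN x : rnorm (- x) = rnorm x.
Proof. by rewrite /rnorm normrN. Qed.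

Lemma rnormD x y : rnorm (x + y) <= rnorm x + rnorm y.
Proof. by rewrite -(@lecR R) rmorphD/= -!normE_rnorm ler_normD. Qed.
End RealNorm.

Lemma rnormZ (R : realType) (V : normedModType R[i]) (a : R[i]) (x : V) :
  rnorm (a *: x) = rnorm a * rnorm x.
Proof.
by apply: (@complexI R); rewrite rmorphM/= -!normE_rnorm normrZ.
Qed.

Lemma rnormM (R : realType) (a b : R[i]) : rnorm (a * b) = rnorm a * rnorm b.
Proof.
by apply: (@complexI R); rewrite rmorphM/= -!normE_rnorm normrM.
Qed.

(** * Sesquilinearity, expansion of squared norms, Cauchy-Schwarz *)

Section Inner.
Variables (R : realType) (H : hilbertType R).
Implicit Types x y : H.

Lemma innerC x y : inner x y = (inner y x)^*.
Proof. by rewrite /inner hermC/= expr0 mul1r. Qed.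

Lemma innerDl x y z : inner (x + y) z = inner x z + inner y z.
Proof. exact: linearDl. Qed.

Lemma innerZl a x y : inner (a *: x) y = a * inner x y.
Proof. exact: linearZl_LR. Qed.

Lemma innerZr a x y : inner x (a *: y) = a^* * inner x y.
Proof. exact: linearZr_LR. Qed.

Lemma innerBl x y z : inner (x - y) z = inner x z - inner y z.
Proof. exact: linearBl. Qed.

Lemma innerBr x y z : inner x (y - z) = inner x y - inner x z.
Proof. exact: linearBr. Qed.

Lemma innerDr x y z : inner x (y + z) = inner x y + inner x z.
Proof. exact: linearDr. Qed.

Lemma inner_suml (T : Type) (s : seq T) (E : T -> H) y :
  inner (\sum_(k <- s) E k) y = \sum_(k <- s) inner (E k) y.
Proof. exact: linear_sumlz. Qed.

Lemma inner_sumr (T : Type) (s : seq T) (E : T -> H) x :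
  inner x (\sum_(k <- s) E k) = \sum_(k <- s) inner x (E k).
Proof. exact: linear_sumr. Qed.

Lemma inner_rnorm x : inner x x = ((rnorm x) ^+ 2)%:C%C.
Proof. by rewrite /inner inner_dot_normE normE_rnorm rmorphXn. Qed.

Lemma rnormD_sqr x y :
  rnorm (x + y) ^+ 2 =
  rnorm x ^+ 2 + rnorm y ^+ 2 + 2 * complex.Re (inner x y).
Proof.
have : complex.Re (inner (x + y) (x + y)) = rnorm (x + y) ^+ 2.
  by rewrite inner_rnorm.
rewrite innerDl !innerDr !inner_rnorm (innerC y x) !raddfD/= => <-.
by case: (inner x y) => a b /=; ring.
Qed.

Lemma rnormZ_sqr (t : R) x : rnorm (t%:C%C *: x) ^+ 2 = t ^+ 2 * rnorm x ^+ 2.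
Proof.
have : complex.Re (inner (t%:C%C *: x) (t%:C%C *: x)) = rnorm (t%:C%C *: x) ^+ 2.
  by rewrite inner_rnorm.
by rewrite innerZl innerZr inner_rnorm/= => <-; ring.
Qed.

Lemma Re_innerZr (t : R) x y :
  complex.Re (inner x (t%:C%C *: y)) = t * complex.Re (inner x y).
Proof. by rewrite innerZr; case: (inner x y) => a b /=; ring. Qed.

Lemma Re_innerC x y : complex.Re (inner x y) = complex.Re (inner y x).
Proof. by rewrite innerC; case: (inner y x). Qed.

Lemma Re_innerNr x y : complex.Re (inner x (- y)) = - complex.Re (inner x y).
Proof. by rewrite /inner linearNr raddfN. Qed.

Lemma Re_innerNl x y : complex.Re (inner (- x) y) = - complex.Re (inner x y).
Proof. by rewrite Re_innerC Re_innerNr Re_innerC. Qed.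

(** Square the triangle inequality and compare with the expansion of [rnorm (x + y) ^+ 2]. *)
Lemma Re_inner_le x y : complex.Re (inner x y) <= rnorm x * rnorm y.
Proof.
have := rnormD_sqr x y; have := rnormD x y.
move: (rnorm_ge0 (x + y)) (rnorm_ge0 x) (rnorm_ge0 y).
by move: (rnorm (x + y)) (rnorm x) (rnorm y) => c a b; nra.
Qed.
End Inner.

(** * Riesz representation by minimization *)

Section Riesz.
Variables (R : realType) (H : hilbertType R).

Lemma riesz (phi : H -> R[i]) (M : R) :
  scalar phi -> (forall x, `|complex.Re (phi x)| <= M * rnorm x) ->
  exists h, forall x, phi x = inner x h.
Proof.
move=> lin bnd; pose r x := complex.Re (phi x).
have rD x y : r (x + y) = r x + r y.
  by rewrite /r -[x]scale1r lin mul1r scale1r raddfD.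
have phi0 : phi 0 = 0.
  by have := lin (-1) 0 0; rewrite scaler0 addr0 mulN1r addNr.
have phiZ a x : phi (a *: x) = a * phi x.
  by rewrite -[a *: x]addr0 lin phi0 addr0.
have rZ (t : R) x : r (t%:C%C *: x) = t * r x.
  by rewrite /r phiZ; case: (phi x) => a b /=; ring.
have rN x : r (- x) = - r x by rewrite /r -scaleN1r phiZ mulN1r raddfN.
(* If [h] represents [phi], then [F x] is [|x - h|^2 - |h|^2], so the vector sought can only be the
   minimizer of [F]. *)
pose F x := rnorm x ^+ 2 - 2 * r x.
have FD x y : F (x + y) = F x + rnorm y ^+ 2
    + 2 * (complex.Re (inner x y) - r y).
  by rewrite /F rD rnormD_sqr; ring.
have F_lb : has_lbound (range F).
  (* Completing the square: [F x >= |x|^2 - 2 M |x| = (|x| - M)^2 - M^2]. *)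
  exists (- M ^+ 2) => _ [x _ <-].
  have := bnd x; rewrite ler_norml => /andP[_ ub].
  have := sqr_ge0 (rnorm x - M); rewrite /F /r.
  by nra.
have F_inf : has_inf (range F) by split => //; exists (F 0), 0.
pose d := inf (range F).
have dF x : d <= F x by apply: ge_inf => //; exists x.
have /choice[u uP] : forall n, exists x, F x < d + n.+1%:R^-1.
  move=> n.
  have n0 : 0 < n.+1%:R^-1 :> R by rewrite invr_gt0.
  by have [_ [x _ <-] ?] := inf_adherent n0 F_inf; exists x.
(* The parallelogram identity, which makes minimizing sequences of [F] Cauchy. *)
have F_mid x y :
    rnorm (x - y) ^+ 2 = 2 * (F x + F y) - 4 * F ((2^-1)%:C%C *: (x + y)).
  have -> : F ((2^-1)%:C%C *: (x + y)) = 4^-1 * rnorm (x + y) ^+ 2 - r x - r y.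
    by rewrite /F rZ rnormZ_sqr rD; field.
  by rewrite /F !rnormD_sqr rnormN Re_innerNr; field.
have /cvg_ex[h uh] : cvg (u @ \oo).
  apply: cauchy_cvg; apply/cauchy_ballP => eps eps0; near_simpl.
  have epsE : eps = (complex.Re eps)%:C%C by rewrite RRe_real// gtr0_real.
  have e0 : 0 < complex.Re eps by rewrite -(@ltcR R) -epsE.
  have e20 : 0 < complex.Re eps ^+ 2 / 4 by rewrite divr_gt0// exprn_gt0.
  (* Both values of [F] are within [eps^2 / 4] of [d] and the midpoint value is at least [d], so
     [F_mid] gives [|u n - u m|^2 < 2 (eps^2 / 4 + eps^2 / 4) = eps^2]. *)
  near=> n m => /=.
  rewrite -ball_normE/= normE_rnorm epsE ltcR.
  rewrite -(@ltr_sqr R) ?nnegrE ?rnorm_ge0 ?(ltW e0)// F_mid.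
  have un : n.+1%:R^-1 < complex.Re eps ^+ 2 / 4.
    by near: n; exact: (near_infty_natSinv_lt (PosNum e20)).
  have um : m.+1%:R^-1 < complex.Re eps ^+ 2 / 4.
    by near: m; exact: (near_infty_natSinv_lt (PosNum e20)).
  have := uP n; have := uP m; have := dF ((2^-1)%:C%C *: (u n + u m)).
  have arith (a b e D Fmid Fn Fm : R) : a < e / 4 -> b < e / 4 -> D <= Fmid ->
      Fm < D + b -> Fn < D + a -> 2 * (Fn + Fm) - 4 * Fmid < e by lra.
  exact: arith.
have Fh x : F h <= F x.
  apply: le_trans (dF x); apply/ler_addgt0Pr => eps eps0.
  (* By [FD] at [h], [F h - F (u n)] is at most [2 (|M| + |h|) |h - u n|]; the [+ 1] makes [C]
     positive, hence a legal divisor. *)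
  pose C := 2 * (`|M| + rnorm h) + 1.
  have C0 : 0 < C by rewrite ltr_wpDl// mulr_ge0// addr_ge0// rnorm_ge0.
  have eps2 : 0 < eps / 2 by rewrite divr_gt0.
  have epsC : 0 < (eps / 2 / C)%:C%C :> R[i] by rewrite ltcR divr_gt0.
  have [n [un hn]] : exists n,
      n.+1%:R^-1 < eps / 2 /\ rnorm (h - u n) < eps / 2 / C.
    near \oo => n; exists n; split.
      by near: n; exact: (near_infty_natSinv_lt (PosNum eps2)).
    rewrite -(@ltcR R) -normE_rnorm; near: n.
    by move/cvgrPdist_lt : uh; exact.
  set y := h - u n in hn.
  have := FD h (- y); rewrite Re_innerNr rnormN.
  have -> : h - y = u n by rewrite /y opprB addrC subrK.
  have rNy : - r y <= `|M| * rnorm y.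
    have := bnd y; rewrite ler_norml => /andP[+ _]; rewrite lerNl => /le_trans; apply.
    by rewrite ler_wpM2r ?rnorm_ge0// ler_norm.
  have Cy : 2 * (`|M| * rnorm y + rnorm h * rnorm y) + rnorm y < eps / 2.
    by rewrite -mulrDl mulrA -[X in _ + X]mul1r -mulrDl mulrC -ltr_pdivlMr.
  have arith (Fu D a P Q s t c p : R) : a < eps / 2 -> 2 * (P + Q) + t < eps / 2 ->
      - p <= P -> c <= Q -> 0 <= s -> 0 <= t -> Fu < D + a ->
      Fu = F h + s + 2 * (- c - - p) -> F h <= D + eps by move: (F h) => ?; lra.
  rewrite rN; apply: (arith _ _ _ _ _ _ _ _ _ un Cy rNy (Re_inner_le h y)) => //.
  - exact: sqr_ge0.
  - exact: rnorm_ge0.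
have Re_h x : r x = complex.Re (inner x h).
  rewrite Re_innerC; apply/eqP; rewrite eq_sym -subr_eq0; apply/eqP.
  set c := _ - _.
  (* [F] has its minimum at [h], hence the slope [c] at [h] in the direction [x]
     vanishes: compare [F h] with [F (h - (c / q) x)]. *)
  pose q := rnorm x ^+ 2 + 1.
  have q1 : 1 <= q by rewrite lerDr sqr_ge0.
  have := Fh (h + (- (c / q))%:C%C *: x).
  rewrite FD rnormZ_sqr rZ Re_innerZr -mulrBr -/c.
  have [s cE] : exists s, c = s * q.
    by exists (c / q); rewrite divfK// gt_eqF// (lt_le_trans ltr01).
  rewrite cE mulfK ?gt_eqF ?(lt_le_trans ltr01)//.
  have -> : rnorm x ^+ 2 = q - 1 by rewrite addrK.
  move=> /= Fs.
  (* [Fs] reads [0 <= s^2 (q - 1) - 2 s^2 q = - s^2 (q + 1)]. *)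
  have s2 : s ^+ 2 <= 0 by have := sqr_ge0 s; nra.
  have : s ^+ 2 == 0 by rewrite eq_le s2 sqr_ge0.
  by rewrite sqrf_eq0 => /eqP ->; rewrite mul0r.
exists h => x.
(* The real part at [- i x] is the imaginary part at [x]. *)
have := Re_h x; have := Re_h ((- 'i)%C *: x).
rewrite /r phiZ innerZl.
case: (phi x) => a b; case: (inner x h) => a' b' /= bE ->.
by have -> : b = b' by lra.
Unshelve. all: by end_near. Qed.
End Riesz.

(** By Cauchy-Schwarz, [f |-> inner (L f) g] is bounded with constant [M * rnorm g], so [riesz]
    shows that the set from which [xget] chooses is inhabited. *)
Lemma adjointP (R : realType) (H1 H2 : hilbertType R) (L : {linear H1 -> H2}) :
  bounded_operator L ->
  forall f g, inner (L f) g = inner f (adjoint L g).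
Proof.
move=> [M bL] f g; move: f.
suff [h hP] : exists h, forall f, inner (L f) g = inner f h.
  exact: (@xgetPex _ _ [set h | forall f, inner (L f) g = inner f h] (ex_intro _ h hP)).
apply: (@riesz _ _ _ (M * rnorm g)) => [a x y|x].
  by rewrite linearP innerDl innerZl.
have bLx : rnorm (L x) * rnorm g <= M * rnorm g * rnorm x.
  by rewrite mulrAC ler_wpM2r ?rnorm_ge0.
rewrite ler_norml (le_trans (Re_inner_le _ _) bLx) andbT lerNl -Re_innerNl.
by apply: le_trans (Re_inner_le _ _) _; rewrite rnormN.
Qed.

(** * Bessel's inequality and Parseval's identity *)

Section Parseval.
Variables (R : realType) (H : hilbertType R) (T : choiceType).
Variables (K : set T) (e : T -> H).

(** Expand by orthonormality and complete the square in each [c k]. Fourier coefficients as [c]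
    yield Bessel; arbitrary [c] yield the lower bound in Parseval. *)
Lemma orthonormal_dist_sqr (s : seq T) (c : T -> R[i]) (x : H) :
  orthonormal_family K e -> uniq s -> (forall k, k \in s -> K k) ->
  rnorm (x - \sum_(k <- s) c k *: e k) ^+ 2 =
  rnorm x ^+ 2 - \sum_(k <- s) rnorm (inner x (e k)) ^+ 2
  + \sum_(k <- s) rnorm (c k - inner x (e k)) ^+ 2.
Proof.
move=> ortho us sK.
set S := \sum_(k <- s) c k *: e k.
have xS : inner x S = \sum_(k <- s) (c k)^* * inner x (e k).
  by rewrite inner_sumr; apply: eq_bigr => k _; rewrite innerZr.
have Sx : inner S x = \sum_(k <- s) c k * (inner x (e k))^*.
  by rewrite inner_suml; apply: eq_bigr => k _; rewrite innerZl innerC.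
have SS : inner S S = \sum_(k <- s) c k * (c k)^*.
  rewrite inner_suml; apply: eq_big_seq => k ks.
  rewrite innerZl inner_sumr (bigD1_seq k)//= innerZr ortho ?eqxx ?mulr1; try exact: sK.
  rewrite big1_seq ?addr0// => l /andP[lk ls].
  by rewrite innerZr ortho ?(eq_sym k) ?(negPf lk) ?mulr0; try exact: sK.
apply: (@complexI R); rewrite rmorphD rmorphB/= !rmorph_sum/= -!inner_rnorm.
rewrite innerBl !innerBr xS Sx SS !inner_rnorm.
rewrite -!addrA; congr (_ + _); rewrite opprB addrA -!sumrN -!big_split/=.
apply: eq_bigr => k _; rewrite !rmorphXn/= -!normE_rnorm !normCK rmorphB/=.
by ring.
Qed.

Lemma bessel (s : seq T) (x : H) :
  orthonormal_family K e -> uniq s -> (forall k, k \in s -> K k) ->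
  \sum_(k <- s) rnorm (inner x (e k)) ^+ 2 <= rnorm x ^+ 2.
Proof.
move=> ortho us sK; rewrite -subr_ge0.
have := orthonormal_dist_sqr (fun k => inner x (e k)) x ortho us sK.
rewrite [X in _ = _ + X]big1 ?addr0 => [<-|k _]; first exact: sqr_ge0.
by rewrite subrr /rnorm normr0 expr0n.
Qed.

(** Repeated indices are merged by multiplying each coefficient by its multiplicity, since
    [orthonormal_dist_sqr] needs a duplicate-free list. *)
Lemma lin_span_uniq (y : H) : lin_span K e y ->
  exists s (c : T -> R[i]), [/\ uniq s, forall k, k \in s -> K k &
    y = \sum_(k <- s) c k *: e k].
Proof.
move=> [s [c [sK ->]]].
exists (undup s), (fun k => c k *+ count_mem k s); split.
- exact: undup_uniq.
- by move=> k; rewrite mem_undup; exact: sK.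
- rewrite -big_undup_iterop_count/=; apply: eq_bigr => k _.
  by rewrite -scalerMnl.
Qed.

Lemma parseval (x : H) : orthonormal_basis K e ->
  (\esum_(k in K) (rnorm (inner x (e k)) ^+ 2)%:E = (rnorm x ^+ 2)%:E)%E.
Proof.
move=> [ortho dspan]; apply/eqP; rewrite eq_le; apply/andP; split.
  (* Bessel bounds every finite partial sum. *)
  apply: ge_ereal_sup => _ [A [finA AK] <-].
  rewrite fsbig_finite//= sumEFin lee_fin bessel// => k.
  by rewrite in_fset_set// inE; exact: AK.
apply/lee_addgt0Pr => eps eps0.
(* Density gives [y] in the span with [|x - y|^2 <= eps]; the partial sum over its support [s] then
   misses [|x|^2] by at most [eps]. *)
have [y [bxy /lin_span_uniq[s [c [us sK yE]]]]] :
    (ball x (Num.sqrt eps)%:C%C : set H) `&` lin_span K e !=set0.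
  apply: dspan; last exact: ball_open.
  by exists x; apply: ballxx; rewrite ltcR sqrtr_gt0.
have xy : rnorm (x - y) ^+ 2 <= eps.
  move: bxy; rewrite -ball_normE/= normE_rnorm ltcR => /ltW.
  rewrite -(@ler_sqr R) ?nnegrE ?rnorm_ge0 ?sqrtr_ge0// sqr_sqrtr//.
  exact: ltW.
apply: (@le_trans _ _ ((\sum_(k <- s) rnorm (inner x (e k)) ^+ 2)%:E + eps%:E)%E).
  rewrite lee_fin; move: xy; rewrite yE orthonormal_dist_sqr//.
  have : 0 <= \sum_(k <- s) rnorm (c k - inner x (e k)) ^+ 2.
    by apply: sumr_ge0 => k _; exact: sqr_ge0.
  by move=> ? ?; lra.
apply: leeD => //; apply: esum_ge; exists [set` s].
  by split => //; exact: finite_seq.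
by rewrite -fsbig_seq// sumEFin.
Qed.
End Parseval.

(** * Frame bounds of the induced sequence *)

Unset Implicit Arguments.

Theorem proposition5p2 (R : realType) (H : hilbertType R)
    (J : set int) (K : int -> set int) (Hi : int -> hilbertType R)
    (Lambda : forall i : int, {linear H -> Hi i}) (w : int -> R[i])
    (e : forall i : int, int -> Hi i)
    (sepH : separable H)
    (sepHi : forall i, J i -> separable (Hi i))
    (bndLambda : forall i, J i -> bounded_operator (Lambda i))
    (gframe : weighted_g_frame J w Lambda)
    (onb : forall i, J i -> orthonormal_basis (K i) (e i)) :
  weighted_frame (J `*`` K)
    (fun p : int * int => w p.1)
    (fun p : int * int => adjoint (Lambda p.1) (e p.1 p.2)).
Proof.
have [m [M [m0 mM]]] := gframe.
apply/weighted_frameE; exists m, M; split => // f.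
have <- : (\esum_(i in J) (rnorm (w i) ^+ 2 * rnorm (Lambda i f) ^+ 2)%:E =
    \esum_(p in J `*`` K) (rnorm (w p.1) ^+ 2 *
      rnorm (inner f (adjoint (Lambda p.1) (e p.1 p.2))) ^+ 2)%:E)%E.
  (* Nonnegativity of the terms lets the sum over pairs be iterated. *)
  rewrite -(@esum_esum _ _ _ _ _ (fun i k => (rnorm (w i) ^+ 2 *
      rnorm (inner f (adjoint (Lambda i) (e i k))) ^+ 2)%:E)); last first.
    by move=> i k _ _; rewrite lee_fin mulr_ge0// sqr_ge0.
  apply: eq_esum => i Ji.
  (* The weight goes inside the norm, so no scalar has to leave an extended-real sum. *)
  rewrite -exprMn -rnormZ -(parseval _ (onb i Ji)).
  apply: eq_esum => k _.
  by rewrite innerZl -(adjointP (bndLambda i Ji)) -exprMn -rnormM.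
exact: mM.
Qed.
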